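(* Let $\Lambda$ be a totally ordered nontrivial abelian group. Assume that $G$ is a topological group acting on a $\Lambda$-tree $(X,d)$ by isometries in such a way that for some $x_0\in X$ the map $G\ni g\mapsto gx_0\in X$ is continuous. Let $\lVert\cdot\rVert\colon G\to\Lambda_{+}$ be the translation length function of this action. If $(a,b)\in G\times G$ is a ping-pong pair with respect to $\lVert\cdot\rVert$, then the subgroup $\langle a,b\rangle$ is free of rank two and discrete.
   Context: $\Lambda$ is written additively; $\Lambda_{+}:=\{\lambda\in\Lambda:\lambda\ge 0\}$ and $|\lambda|:=\max\{\lambda,-\lambda\}$. A $\Lambda$-metric space $(X,d)$ is defined by the usual axioms of a metric space, except that $d$ takes values in $\Lambda$; it carries the topology with the family of open balls as a basis. $\Lambda$ itself is a $\Lambda$-metric space with $d(x,y)=|x-y|$. Isometries are surjective distance-preserving maps; an isometric embedding is a distance-preserving map that need not be surjective. A segment in $(X,d)$ is the image of an isometric embedding $i\colon[p,q]_\Lambda\to X$ of a closed interval $[p,q]_\Lambda=\{x\in\Lambda: p\le x\le q\}$, $p\le q$ in $\Lambda$; $i(p),i(q)$ are its endpoints. $(X,d)$ is geodesic if any two points are the endpoints of some segment. A $\Lambda$-tree is a geodesic $\Lambda$-metric space such that: (i) if two segments intersect in a single point which is an endpoint of both, then their union is a segment; (ii) the intersection of two segments with a common endpoint is a segment. An isometry $g$ of a $\Lambda$-tree is an inversion if $g$ has no fixed point in $X$ but $g^2$ does. The translation length of $g$ is $\lVert g\rVert:=0$ if $g$ is an inversion, and $\lVert g\rVert:=\min\{d(x,gx):x\in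 X\}$ otherwise (the minimum exists). For an action of $G$ by isometries, the translation length function assigns to $g\in G$ the translation length of the isometry by which $g$ acts. $(g,h)\in G\times G$ is a ping-pong pair (with respect to $\lVert\cdot\rVert$) if $\lVert g\rVert>0$, $\lVert h\rVert>0$, and $\bigl|\lVert g\rVert-\lVert h\rVert\bigr|<\min\{\lVert gh\rVert,\lVert gh^{-1}\rVert\}$. A subgroup of $G$ is discrete if it is discrete in the topology inherited from $G$. *)

(* Defs.v *)
From HB Require Import structures.
From mathcomp Require Import all_boot all_order all_algebra.
From mathcomp Require Import all_classical topology.

Set Implicit Arguments.
Unset Strict Implicit.
Unset Printing Implicit Defensive.

Import Order.TTheory GRing.Theory.
Local Open Scope classical_set_scope.
Local Open Scope ring_scope.

(* [Num.POrderedZmodule] does not relate the order to the addition. Totality is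
   an axiom rather than an [Order.Total] superclass, which would overlap with
   [Num.RealDomain] in the hierarchy. *)
HB.mixin Record isOrderedZmodule L & Num.POrderedZmodule L := {
  ozmod_le_total : total (<=%R : rel L) ;
  ozmod_lerD2r : forall z x y : L, x <= y -> x + z <= y + z
}.

#[short(type="orderedZmodType")]
HB.structure Definition OrderedZmodule :=
  { L of Num.POrderedZmodule L & isOrderedZmodule L }.

(* [Num.norm] requires a semi-normed Z-module, which [L] is not. *)
Definition oabs (L : orderedZmodType) (x : L) : L := Order.max x (- x).

Definition lball_of (L : orderedZmodType) (X : Type) (dist : X -> X -> L)
  (x : X) (r : L) : set X := [set y | dist x y < r].

HB.mixin Record isLambdaMetric (L : orderedZmodType) X & Topological X := {
  ldist : X -> X -> L ;
  ldist_ge0 : forall x y, 0 <= ldist x y ;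
  ldist_eq0 : forall x y, ldist x y = 0 <-> x = y ;
  ldistC : forall x y, ldist x y = ldist y x ;
  ldist_triangle : forall x y z, ldist x z <= ldist x y + ldist y z ;
  lball_basis :
    basis [set B | exists x r, 0 < r /\ B = lball_of ldist x r]
}.

#[short(type="lambdaMetricType")]
HB.structure Definition LambdaMetric (L : orderedZmodType) :=
  { X of Topological X & isLambdaMetric L X }.

Section LambdaTree.
Variables (L : orderedZmodType) (X : lambdaMetricType L).

Definition isometry (f : X -> X) : Prop :=
  (forall x y, ldist (f x) (f y) = ldist x y) /\ range f = setT.

Definition segment_between (x y : X) (S : set X) : Prop :=
  exists (p q : L) (i : L -> X),
    [/\ p <= q,
        {in `[p, q] &, forall s t, ldist (i s) (i t) = oabs (s - t)},
        S = i @` `[p, q]%classic,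
        x = i p
      & y = i q].

Definition segment (S : set X) : Prop := exists x y, segment_between x y S.

Definition segment_endpoint (x : X) (S : set X) : Prop :=
  exists y, segment_between x y S \/ segment_between y x S.

Definition lambda_geodesic : Prop :=
  forall x y, exists S, segment_between x y S.

Definition lambda_tree : Prop :=
  [/\ lambda_geodesic,
      forall S T x, segment_endpoint x S -> segment_endpoint x T ->
        S `&` T = [set x] -> segment (S `|` T)
    & forall S T x, segment_endpoint x S -> segment_endpoint x T ->
        segment (S `&` T)].

Definition inversion (f : X -> X) : Prop :=
  (forall x, f x <> x) /\ exists x, f (f x) = x.

(* The minimum of the displacements is attained for every isometry of a
   Lambda-tree that is not an inversion; [xget] returns its default value 0
   when there is no minimum. *)
Definition translation_length (f : X -> X) : L :=
  let displacements := range (fun x => ldist x (f x)) in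
  if `[< inversion f >] then 0
  else xget 0 (displacements `&` lbound displacements).

End LambdaTree.

Local Open Scope group_scope.

HB.mixin Record isTopologicalGroup G & Topological G & Group G := {
  mulg_continuous : continuous (fun x : G * G => x.1 * x.2) ;
  invg_continuous : continuous (fun x : G => x^-1)
}.

#[short(type="topologicalGroupType")]
HB.structure Definition TopologicalGroup :=
  { G of Topological G & Group G & isTopologicalGroup G }.

Definition isometric_action (L : orderedZmodType) (X : lambdaMetricType L)
    (G : groupType) (act : G -> X -> X) : Prop :=
  [/\ forall x, act 1 x = x,
      forall g h x, act (g * h) x = act g (act h x)
    & forall g, isometry (act g)].

Definition ping_pong_pair (L : orderedZmodType) (G : groupType) (len : G -> L)
    (g h : G) : Prop :=
  [/\ (0 < len g)%R, (0 < len h)%R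
    & (oabs (len g - len h) <
         Order.min (len (g * h)%g) (len (g * h^-1)%g))%R].

Section Generated.
Variable G : groupType.

Definition generated (S : set G) : set G :=
  smallest [set H : set G | group_closed (mem H)] S.

Variable S : set G.

Lemma generated_group_closed : group_closed (mem (generated S)).
Proof.
split; first by rewrite inE => H [[H1 _] _]; rewrite inE in H1.
move=> x y; rewrite !inE => Sx Sy H HP; have [[_ HV] _] := HP.
by have := HV x y; rewrite !inE; apply; [exact: Sx | exact: Sy].
Qed.

Definition generated_group : Type := set_type (generated S).

HB.instance Definition _ := SubChoice.copy generated_group {x | x \in generated S}.
HB.instance Definition _ :=
  SubChoice_isSubGroup.Build G (fun x => x \in generated S)
    generated_group generated_group_closed.

End Generated.

HB.instance Definition _ (G : topologicalGroupType) (S : set G) :=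
  Topological.copy (generated_group S) (set_type (generated S)).

(* Universal property of a free group on the basis [e 0, ..., e (n - 1)]. *)
Definition free_basis (F : groupType) (n : nat) (e : 'I_n -> F) : Prop :=
  forall (K : groupType) (f : 'I_n -> K),
    exists2 phi : {multiplicative F -> K}, forall i, phi (e i) = f i
      & forall psi : {multiplicative F -> K},
          (forall i, psi (e i) = f i) -> psi =1 phi.

Definition free_of_rank (n : nat) (F : groupType) : Prop :=
  exists e : 'I_n -> F, free_basis e.

Definition discrete_space (T : topologicalType) : Prop :=
  forall x : T, nbhs x = principal_filter x.

(* Main.v *)
Require Import Defs.
From HB Require Import structures.
From mathcomp Require Import all_boot all_order all_algebra.
From mathcomp Require Import all_classical topology.

(* Fix a base point p and write l(g) = d(p, gp). A Lambda-tree satisfies the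
   four-point inequality, and this makes l determined locally: if
     l(s) + l(u) < l(st) + l(tu)
   for all letters s, t, u such that stu is a reduced word in a, b and their
   inverses, then l(w) is, for a reduced word w, an explicit sum over pairs of
   consecutive letters. Combined with d(x, gx) >= l(g^2) - l(g), valid for every
   x, this bounds below the displacement of each nontrivial reduced word by a
   constant independent of the word and of x, which gives both freeness and
   discreteness.

   The base point is the projection on the axis of a of any point of the axis of
   b. If p is not on the axis of b, it is an endpoint of the bridge between the
   two axes. Otherwise the axes overlap, and if the overlap were as long as the
   smaller of the two translation lengths, some w on it would satisfy
   d(aw, bw) <= | |a| - |b| | (or the same with b^-1), which the ping-pong
   condition excludes. *)

Set Implicit Arguments.
Unset Strict Implicit.
Unset Printing Implicit Defensive.

Import Order.TTheory GRing.Theory Num.Theory.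
Local Open Scope classical_set_scope.
Local Open Scope ring_scope.

(** * Linear arithmetic over ordered abelian groups *)

Section OrderedZmodTheory.
Variable L : orderedZmodType.
Implicit Types x y z t : L.

Lemma ole_add x y z t : x <= y -> z <= t -> x + z <= y + t.
Proof.
move=> xy zt; apply: (le_trans (ozmod_lerD2r z _ _ xy)).
by rewrite ![y + _]addrC; apply: ozmod_lerD2r.
Qed.

Lemma osubr_ge0 x y : (0 <= y - x) = (x <= y).
Proof.
apply/idP/idP => [/(ozmod_lerD2r x)|/(ozmod_lerD2r (- x))].
  by rewrite add0r subrK.
by rewrite subrr.
Qed.

Lemma osubr_gt0 x y : (0 < y - x) = (x < y).
Proof. by rewrite !lt_def subr_eq0 osubr_ge0. Qed.

Lemma oadd_ge0 x y : 0 <= x -> 0 <= y -> 0 <= x + y.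
Proof. by move=> x0 y0; rewrite -[0]addr0 ole_add. Qed.

Lemma oltNge x y : (x < y) = ~~ (y <= x).
Proof.
case: (boolP (y <= x)) => [yx|nyx]; first by rewrite le_gtF.
have := ozmod_le_total x y; rewrite (negPf nyx) orbF le_eqVlt => /orP[/eqP xy|//].
by rewrite xy lexx in nyx.
Qed.

Lemma oleVlt x y : x <= y \/ y < x.
Proof. by rewrite oltNge; case: (x <= y); [left|right]. Qed.

End OrderedZmodTheory.

(** * Elimination of variables from integer linear systems *)

Section FourierMotzkin.

Inductive lexpr :=
  | LVar of nat | LZero | LAdd of lexpr & lexpr | LOpp of lexpr | LMuln of lexpr & nat.

(** Coefficient vectors; missing trailing entries count as zero. *)
Definition lform := seq int.

Fixpoint ladd (c d : lform) : lform :=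
  match c, d with
  | [::], _ => d
  | _, [::] => c
  | x :: c', y :: d' => (x + y) :: ladd c' d'
  end.

Definition lscale (k : int) : lform -> lform := map (fun x => k * x).

Fixpoint lnorm (e : lexpr) : lform :=
  match e with
  | LVar n => rcons (nseq n 0) 1
  | LZero => [::]
  | LAdd e1 e2 => ladd (lnorm e1) (lnorm e2)
  | LOpp e1 => lscale (-1) (lnorm e1)
  | LMuln e1 n => lscale n%:Z (lnorm e1)
  end.

Inductive lkind := LEq | LLe | LLt.

Definition lrel := (lkind * lform)%type.

Definition lhead (c : lrel) : int := head 0 c.2.
Definition ltail (c : lrel) : lrel := (c.1, behead c.2).

Definition lkind_max (k1 k2 : lkind) : lkind :=
  match k1, k2 with
  | LLt, _ | _, LLt => LLt
  | LLe, _ | _, LLe => LLe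
  | LEq, LEq => LEq
  end.

Definition lcomb (m : int) (c : lrel) (n : int) (d : lrel) : lrel :=
  (lkind_max c.1 d.1, ladd (lscale m (behead c.2)) (lscale n (behead d.2))).

(** [c] is multiplied by the positive integer [|lhead e|], which preserves inequalities and avoids
    division in [L]; all signs go into the multiple of the equation [e]. *)
Definition lpivot (e c : lrel) : lrel :=
  if lhead c == 0 then ltail c
  else (c.1, ladd (lscale `|lhead e|%N%:Z (behead c.2))
                  (lscale (- (sgz (lhead e) * lhead c)) (behead e.2))).

Definition lis_pivot (c : lrel) : bool :=
  if c.1 is LEq then lhead c != 0 else false.

Definition ltrivial (c : lrel) : bool :=
  if c.1 is LLt then false else all (pred1 0) c.2.

(* One round of elimination of the first variable: Gaussian if some equation
   involves it, Fourier-Motzkin otherwise. *)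
Definition lelim (s : seq lrel) : seq lrel :=
  let r :=
    if [seq c <- s | lis_pivot c] is e :: _ then map (lpivot e) s
    else
      let pos := [seq c <- s | 0 < lhead c] in
      let neg := [seq c <- s | lhead c < 0] in
      map ltail [seq c <- s | lhead c == 0] ++
      flatten [seq [seq lcomb (- lhead d) c (lhead c) d | d <- neg] | c <- pos] in
  [seq c <- r | ~~ ltrivial c].

(** Each round removes one variable. With [n] variables, a strict constraint left after [n] rounds
    reads $0 < 0$. *)
Definition lrefutes (n : nat) (s : seq lrel) : bool :=
  has (fun c => if c.1 is LLt then all (pred1 0) c.2 else false) (iter n lelim s).

Variable L : orderedZmodType.
Implicit Types env : seq L.

Fixpoint leval_expr env (e : lexpr) : L :=
  match e with
  | LVar n => nth 0 env n
  | LZero => 0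
  | LAdd e1 e2 => leval_expr env e1 + leval_expr env e2
  | LOpp e1 => - leval_expr env e1
  | LMuln e1 n => leval_expr env e1 *+ n
  end.

Fixpoint leval env (c : lform) : L :=
  match env, c with
  | v :: env', x :: c' => v *~ x + leval env' c'
  | _, _ => 0
  end.

Definition lkind_holds (k : lkind) (x : L) : bool :=
  match k with LEq => x == 0 | LLe => 0 <= x | LLt => 0 < x end.

Definition lholds env (c : lrel) : bool := lkind_holds c.1 (leval env c.2).

Lemma leval_nil env : leval env [::] = 0. Proof. by case: env. Qed.

Lemma leval_add env c d : leval env (ladd c d) = leval env c + leval env d.
Proof.
elim: env c d => [|v env IH] [|x c] [|y d] //=; rewrite ?add0r ?addr0 //.
by rewrite IH mulrzDr addrACA.
Qed.

Lemma leval_scale env k c : leval env (lscale k c) = leval env c *~ k.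
Proof.
elim: env c => [|v env IH] [|x c] //=; rewrite ?mul0rz //.
by rewrite IH mulrzDl mulrC mulrzA.
Qed.

Lemma leval_norm env e : leval env (lnorm e) = leval_expr env e.
Proof.
elim: e => [n||e1 IH1 e2 IH2|e IH|e IH n] /=.
- elim: n env => [|n IH] [|v env] //=; first by rewrite leval_nil addr0 mulr1z.
  by rewrite mulr0z add0r IH.
- by rewrite leval_nil.
- by rewrite leval_add IH1 IH2.
- by rewrite leval_scale IH mulrN1z.
- by rewrite leval_scale IH -pmulrn.
Qed.

Lemma leval_head v env c : leval (v :: env) c = v *~ head 0 c + leval env (behead c).
Proof. by case: c => [|x c] //=; rewrite mulr0z leval_nil addr0. Qed.

Lemma lkind_holds_scale k x (m : int) : 0 < m -> lkind_holds k x -> lkind_holds k (x *~ m).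
Proof.
case: m => // -[//|n] _; rewrite -pmulrn.
case: k => /= [/eqP->|x0|x0]; first by rewrite mul0rn.
- by elim: n => [|n IH]; rewrite ?mulr1n // mulrS oadd_ge0.
- elim: n => [|n IH]; rewrite ?mulr1n // mulrS.
  by rewrite (lt_le_trans x0) // -osubr_ge0 addrAC subrr add0r ltW.
Qed.

Lemma lkind_holds_add k1 k2 x y : lkind_holds k1 x -> lkind_holds k2 y ->
  lkind_holds (lkind_max k1 k2) (x + y).
Proof.
case: k1; case: k2 => /= hx hy; rewrite ?(eqP hx) ?(eqP hy) ?hx ?hy ?add0r ?addr0 //.
- exact: oadd_ge0.
- by rewrite (lt_le_trans hy) // -osubr_ge0 addrK.
- by rewrite (lt_le_trans hx) // -osubr_ge0 addrAC subrr add0r.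
- by rewrite (lt_le_trans hx) // -osubr_ge0 addrAC subrr add0r ltW.
Qed.

Lemma lholds_comb v env m c n d : 0 < m -> 0 < n ->
  m * lhead c + n * lhead d = 0 -> lholds (v :: env) c -> lholds (v :: env) d ->
  lholds env (lcomb m c n d).
Proof.
rewrite /lholds /lcomb !leval_head /= leval_add !leval_scale => m0 n0 mn hc hd.
have := lkind_holds_add (lkind_holds_scale m0 hc) (lkind_holds_scale n0 hd).
rewrite !mulrzDl addrACA -!mulrzA -mulrzDr.
by rewrite [_ * m]mulrC [_ * n]mulrC mn mulr0z add0r.
Qed.

Lemma lholds_tail v env c : lhead c == 0 -> lholds (v :: env) c ->
  lholds env (ltail c).
Proof. by rewrite /lholds leval_head => /eqP; rewrite /lhead => ->; rewrite mulr0z add0r. Qed.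

Lemma lholds_pivot v env e c : lis_pivot e -> lholds (v :: env) e ->
  lholds (v :: env) c -> lholds env (lpivot e c).
Proof.
case: e => -[] // e; rewrite {1}/lis_pivot /lhead /= => e0; rewrite /lpivot.
case: ifP => [c0 _|_]; first exact: lholds_tail.
rewrite /lholds !leval_head /= leval_add !leval_scale /lhead /= => /eqP he hc.
have p0 : 0 < (absz (head 0%R e))%:Z by rewrite ltz_nat absz_gt0.
have := lkind_holds_scale p0 hc; congr lkind_holds.
move: e0 he; set h := head 0 e; set k := head 0 c.2; move=> e0 he.
have {he} -> : leval env (behead e) = - (v *~ h) by apply/eqP; rewrite -addr_eq0 addrC he.
rewrite mulrzDl addrC -!mulrzA mulrNz mulNrz opprK -mulrzA; congr (_ + v *~ _).
by rewrite abszEsg mulrC [sgz h * h]mulrC -mulrA.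
Qed.

Lemma all_flatten_seq T (P : pred T) (ss : seq (seq T)) :
  all P (flatten ss) = all (all P) ss.
Proof. by elim: ss => //= s ss IH; rewrite all_cat IH. Qed.

Lemma lholds_elim v env s : all (lholds (v :: env)) s -> all (lholds env) (lelim s).
Proof.
move=> hs; rewrite /lelim all_filter; set r := (X in all _ X).
suff: all (lholds env) r by apply: sub_all => c /= ->; rewrite implybT.
have hsP (P : pred lrel) : all (predI P (lholds (v :: env))) [seq c <- s | P c].
  rewrite all_filter; apply: sub_all hs => c hc /=.
  by rewrite hc andbT implybb.
rewrite {}/r; have := hsP lis_pivot.
case: [seq c <- s | lis_pivot c] => [_|e s' /= /andP[/andP[pe he] _]]; last first.
  by rewrite all_map; apply: sub_all hs => c /= ; exact: lholds_pivot.
rewrite all_cat all_map; apply/andP; split.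
  by apply: sub_all (hsP _) => c /= /andP[]; exact: lholds_tail.
rewrite all_flatten_seq all_map; apply: sub_all (hsP _) => c /= /andP[c0 hc].
rewrite all_map; apply: sub_all (hsP _) => d /= /andP[d0 hd].
apply: (lholds_comb _ _ _ hc hd); rewrite ?oppr_gt0 //.
by rewrite mulNr mulrC addNr.
Qed.

Lemma lrefutesP env s : lrefutes (size env) s -> all (lholds env) s -> False.
Proof.
rewrite /lrefutes; elim: env s => [|v env IH] s /= sat hs.
  move: hs sat; rewrite /lholds; elim: s => [//|[[] c] s /= IH'] /andP[hc /IH'] //.
  by rewrite /= ltxx in hc.
rewrite -iterS iterSr in sat.
exact: IH sat (lholds_elim hs).
Qed.
End FourierMotzkin.

(** * Refutation of linear constraints by reflection *)

Section Refutation.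
Variable L : orderedZmodType.
Implicit Types env : seq L.

Definition lcons_holds env (c : lkind * lexpr) : Prop :=
  let x := leval_expr env c.2 in
  match c.1 with LEq => x = 0 | LLe => is_true (0 <= x) | LLt => is_true (0 < x) end.

(** Curried, so that for a concrete list it is convertible to the goal obtained by generalizing the
    hypotheses. *)
Fixpoint lchain env (s : seq (lkind * lexpr)) : Prop :=
  if s is c :: s' then lcons_holds env c -> lchain env s' else False.

Lemma lrefutes_chain env s :
  lrefutes (size env) [seq (c.1, lnorm c.2) | c <- s] -> lchain env s.
Proof.
move=> sat; have := @lrefutesP L env _ sat.
elim: s {sat} => [|[k e] s IH] /= hF; first exact: hF.
move=> he; apply: IH => hs; apply: hF.
by rewrite hs andbT /lholds leval_norm; case: k he => //= ->; rewrite eqxx.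
Qed.

Lemma ole_by_contra (x y : L) : (y < x -> False) -> x <= y.
Proof. by move=> h; case: (oleVlt x y) => // /h. Qed.

Lemma olt_by_contra (x y : L) : (y <= x -> False) -> x < y.
Proof. by move=> h; case: (oleVlt y x) => // /h. Qed.

Lemma oeq_by_contra (x y : L) : (y < x -> False) -> (x < y -> False) -> x = y.
Proof. by move=> h1 h2; apply/le_anti/andP; split; apply: ole_by_contra. Qed.

Lemma oge0_of_le (x y : L) : x <= y -> 0 <= y - x.
Proof. by rewrite osubr_ge0. Qed.

Lemma ogt0_of_lt (x y : L) : x < y -> 0 < y - x.
Proof. by rewrite osubr_gt0. Qed.

Lemma oeq0_of_eq (x y : L) : x = y -> y - x = 0.
Proof. by move->; rewrite subrr. Qed.

End Refutation.

(* Atoms are compared up to conversion: equal terms may carry syntactically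
   different paths to the same algebraic structure. *)
Ltac olra_index x env :=
  match env with
  | ?y :: ?env' =>
      match constr:(Set) with
      | _ =>
          let _ := match constr:(Set) with _ => first [constr_eq x y | unify x y] end in
          constr:(0%N)
      | _ => let n := olra_index x env' in constr:(S n)
      end
  end.

Ltac olra_atoms t env :=
  lazymatch t with
  | @Algebra.add _ ?x ?y => let env := olra_atoms x env in olra_atoms y env
  | @Algebra.opp _ ?x => olra_atoms x env
  | @Algebra.natmul _ ?x _ => olra_atoms x env
  | @Algebra.zero _ => env
  | _ => match constr:(Set) with
         | _ => let _ := olra_index t env in env
         | _ => constr:(t :: env)
         end
  end.

Ltac olra_reify t env :=
  lazymatch t with
  | @Algebra.add _ ?x ?y =>
      let e := olra_reify x env in let f := olra_reify y env in constr:(LAdd e f)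
  | @Algebra.opp _ ?x => let e := olra_reify x env in constr:(LOpp e)
  | @Algebra.natmul _ ?x ?n => let e := olra_reify x env in constr:(LMuln e n)
  | @Algebra.zero _ => constr:(LZero)
  | _ => let n := olra_index t env in constr:(LVar n)
  end.

Ltac olra_goal_atoms G env :=
  lazymatch G with
  | is_true (@Order.le _ _ _ ?x) -> ?G' => let env := olra_atoms x env in olra_goal_atoms G' env
  | is_true (@Order.lt _ _ _ ?x) -> ?G' => let env := olra_atoms x env in olra_goal_atoms G' env
  | @eq _ ?x _ -> ?G' => let env := olra_atoms x env in olra_goal_atoms G' env
  | False => env
  end.

Ltac olra_goal_reify G env :=
  lazymatch G with
  | is_true (@Order.le _ _ _ ?x) -> ?G' =>
      let e := olra_reify x env in let s := olra_goal_reify G' env in constr:((LLe, e) :: s)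
  | is_true (@Order.lt _ _ _ ?x) -> ?G' =>
      let e := olra_reify x env in let s := olra_goal_reify G' env in constr:((LLt, e) :: s)
  | @eq _ ?x _ -> ?G' =>
      let e := olra_reify x env in let s := olra_goal_reify G' env in constr:((LEq, e) :: s)
  | False => constr:(@nil (prod lkind lexpr))
  end.

Ltac olra_collect L :=
  repeat match goal with
  | H : is_true (@Order.le _ _ _ _) |- _ => generalize (@oge0_of_le L _ _ H); clear H
  | H : is_true (@Order.lt _ _ _ _) |- _ => generalize (@ogt0_of_lt L _ _ H); clear H
  | H : @eq _ _ _ |- _ => generalize (@oeq0_of_eq L _ _ H); clear H
  end.

(** The negated goal (each strict order in turn, for an equation) and the hypotheses over [L] become
    comparisons with 0, which are refuted by elimination. *)
Ltac olra :=
  lazymatch goal with L : OrderedZmodule.type |- _ =>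
    try (match goal with
    | |- is_true (@Order.le _ _ _ _) => apply: (@ole_by_contra L)
    | |- is_true (@Order.lt _ _ _ _) => apply: (@olt_by_contra L)
    | |- @eq _ _ _ => apply: (@oeq_by_contra L)
    | |- False => idtac
    | |- _ => exfalso
    end); intros; olra_collect L;
    lazymatch goal with |- ?G =>
      let env := olra_goal_atoms G (@nil (OrderedZmodule.sort L)) in
      let s := olra_goal_reify G env in
      refine (@lrefutes_chain L env s _); vm_compute; exact isT
    end
  end.

(** * Lambda-trees *)

Lemma oabsP (L : orderedZmodType) (x : L) :
  (0 <= x /\ oabs x = x) \/ (x <= 0 /\ oabs x = - x).
Proof.
rewrite /oabs maxElt; case: ifP => [h|/negbT].
  by right; split=> //; olra.
by rewrite oltNge negbK => h; left; split=> //; olra.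
Qed.

Section Segments.
Variables (L : orderedZmodType) (X : lambdaMetricType L).
Implicit Types (x y z t u v w : X) (S T : set X).

Lemma ldistxx x : ldist x x = 0.
Proof. exact/ldist_eq0. Qed.

Lemma segment_betweenC x y S : segment_between x y S -> segment_between y x S.
Proof.
move=> [p [q [i [pq iso -> -> ->]]]]; exists p, q, (fun r : L => i (p + q - r)); split => //.
- move=> s t; rewrite !in_itv /= => /andP[s1 s2] /andP[t1 t2].
  rewrite iso ?in_itv /=; try (by apply/andP; split; olra).
  by case: (oabsP (p + q - s - (p + q - t))) => -[? ->]; case: (oabsP (s - t)) => -[? ->]; olra.
- apply/seteqP; split => _ /= [s sI <-]; exists (p + q - s).
  + by move: sI; rewrite /= !in_itv /= => /andP[s1 s2]; apply/andP; split; olra.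
  + by congr i; olra.
  + by move: sI; rewrite /= !in_itv /= => /andP[s1 s2]; apply/andP; split; olra.
  + by congr i; olra.
- by congr i; olra.
- by congr i; olra.
Qed.

Lemma segment_mem_l x y S : segment_between x y S -> S x.
Proof.
move=> [p [q [i [pq iso -> -> _]]]]; exists p => //=.
by rewrite in_itv /= lexx.
Qed.

(** The distance from the endpoint [x] is an isometric coordinate on the segment. *)
Lemma segment_dist x y S u v : segment_between x y S -> S u -> S v ->
  (ldist x v <= ldist x u /\ ldist u v = ldist x u - ldist x v) \/
  (ldist x u <= ldist x v /\ ldist u v = ldist x v - ldist x u).
Proof.
move=> [p [q [i [pq iso -> -> _]]]] [s sI <-] [t tI <-].
have pI : p \in `[p, q] by rewrite in_itv /= lexx.
rewrite !iso //; move: sI tI; rewrite /= !in_itv /= => /andP[? ?] /andP[? ?].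
by case: (oabsP (p - s)) => -[? ->]; case: (oabsP (p - t)) => -[? ->];
   case: (oabsP (s - t)) => -[? ->]; (case: (oleVlt s t) => ?; [right|left]); split; olra.
Qed.

Lemma segment_btw x y S u : segment_between x y S -> S u ->
  ldist x u + ldist u y = ldist x y.
Proof.
move=> [p [q [i [pq iso -> -> ->]]]] [s sI <-].
have pI : p \in `[p, q] by rewrite in_itv /= lexx.
have qI : q \in `[p, q] by rewrite in_itv /= lexx pq.
rewrite !iso //; move: sI; rewrite /= !in_itv /= => /andP[? ?].
by case: (oabsP (p - s)) => -[? ->]; case: (oabsP (s - q)) => -[? ->];
   case: (oabsP (p - q)) => -[? ->]; olra.
Qed.

Lemma segment_point x y S r : segment_between x y S -> 0 <= r -> r <= ldist x y ->
  exists2 u, S u & ldist x u = r.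
Proof.
move=> [p [q [i [pq iso -> -> ->]]]] r0.
have pI : p \in `[p, q] by rewrite in_itv /= lexx.
have qI : q \in `[p, q] by rewrite in_itv /= lexx pq.
rewrite iso // => rd; exists (i (p + r)).
  exists (p + r) => //=; rewrite in_itv /=.
  by case: (oabsP (p - q)) => -[? e]; rewrite e in rd; apply/andP; split; olra.
rewrite iso //; first by case: (oabsP (p - (p + r))) => -[? ->]; olra.
rewrite in_itv /=.
by case: (oabsP (p - q)) => -[? e]; rewrite e in rd; apply/andP; split; olra.
Qed.

Lemma segment_inj x y S u v : segment_between x y S -> S u -> S v ->
  ldist x u = ldist x v -> u = v.
Proof.
move=> Sxy Su Sv uv; apply/(@ldist_eq0 _ _ u v).
by case: (segment_dist Sxy Su Sv) => -[? ?]; olra.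
Qed.

Lemma segment_tail x y S w : segment_between x y S -> S w ->
  segment_between w y [set u | S u /\ ldist x w <= ldist x u].
Proof.
move=> [p [q [i [pq iso -> -> ->]]]] [r rI <-].
have pI : p \in `[p, q] by rewrite in_itv /= lexx.
have rI' := rI; rewrite /= in_itv /= in rI'; case/andP: rI' => pr rq.
exists r, q, i; split => //.
- move=> s t; rewrite !in_itv /= => /andP[s1 s2] /andP[t1 t2].
  by apply: iso; rewrite in_itv /=; apply/andP; split; olra.
- apply/seteqP; split => z /=.
    move=> [[s sI <-]]; rewrite !iso //.
    move: (sI); rewrite /= !in_itv /= => /andP[s1 s2].
    case: (oabsP (p - s)) => -[? ->]; case: (oabsP (p - r)) => -[? ->] ?;
      by exists s => //; rewrite /= in_itv /=; apply/andP; split; olra.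
  move=> [s sI <-].
  have sI' : s \in `[p, q].
    by move: sI; rewrite /= !in_itv /= => /andP[? ?]; apply/andP; split; olra.
  split; first by exists s.
  move: sI; rewrite !iso //= in_itv /= => /andP[? ?].
  by case: (oabsP (p - s)) => -[? ->]; case: (oabsP (p - r)) => -[? ->]; olra.
Qed.

Hypothesis X_tree : lambda_tree X.

(** By axiom (ii) $S \cap T$ is a segment; [x] is one of its endpoints, and the other is [w]. *)
Lemma segment_meet x y z S T : segment_between x y S -> segment_between x z T ->
  exists w, [/\ S w, T w, forall u, S u -> ldist x u <= ldist x w -> T u &
    forall u, S u -> T u -> ldist x u <= ldist x w].
Proof.
move=> Sxy Txz.
have [x0 [y0 J]] : segment (S `&` T).
  by have [_ _ hI] := X_tree; apply: (hI S T x); [exists y; left|exists z; left].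
(* [x] lies between [x0] and [y0], while distances on [S] are differences of distances from [x];
   hence $d(x,x_0)$ or $d(x,y_0)$ is 0. *)
wlog xx0 : x0 y0 J / x = x0.
  move=> hw.
  have Jx : (S `&` T) x by split; apply: segment_mem_l; eassumption.
  have [Sx0 _] := segment_mem_l J.
  have [Sy0 _] := segment_mem_l (segment_betweenC J).
  have e := segment_btw J Jx; have := segment_dist Sxy Sx0 Sy0.
  rewrite (ldistC x0 x) in e => h.
  have [?|?] : ldist x x0 = 0 \/ ldist x y0 = 0.
    by case: h => -[? ?]; [right|left]; have := ldist_ge0 x x0;
      have := ldist_ge0 x y0 => ? ?; olra.
  - by apply: (hw _ _ J); apply/(@ldist_eq0 _ _ x x0).
  - by apply: (hw _ _ (segment_betweenC J)); apply/(@ldist_eq0 _ _ x y0).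
rewrite -{}xx0 in J; have [Sy Ty] := segment_mem_l (segment_betweenC J).
exists y0; split=> // u Su.
  move=> /(segment_point J (ldist_ge0 x u))[v [Sv Tv] uv].
  by rewrite -(segment_inj Sxy Sv Su uv).
by move=> Tu; rewrite -(segment_btw J (conj Su Tu)); have := ldist_ge0 u y0 => ?; olra.
Qed.

Lemma segment_three S u v w : segment S -> S u -> S v -> S w ->
  [\/ ldist u w + ldist w v = ldist u v, ldist w u + ldist u v = ldist w v
    | ldist w v + ldist v u = ldist w u].
Proof.
move=> [x [y Sxy]] Su Sv Sw.
have := segment_dist Sxy Su Sv; have := segment_dist Sxy Su Sw; have := segment_dist Sxy Sw Sv.
have := ldistC u v; have := ldistC u w; have := ldistC w v => ? ? ?.
move=> [[? ?]|[? ?]] [[? ?]|[? ?]] [[? ?]|[? ?]];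
  by [apply: Or31; olra|apply: Or32; olra|apply: Or33; olra].
Qed.

Lemma segment_btw_inj S x y u v : segment S -> S x -> S y -> S u -> S v ->
  ldist x u + ldist u y = ldist x y -> ldist x v + ldist v y = ldist x y ->
  ldist x u = ldist x v -> u = v.
Proof.
move=> [a [b Sab]] Sx Sy Su Sv h1 h2 h3; apply/(@ldist_eq0 _ _ u v).
have := segment_dist Sab Su Sx; have := segment_dist Sab Sv Sx.
have := segment_dist Sab Su Sy; have := segment_dist Sab Sv Sy.
have := segment_dist Sab Su Sv; have := segment_dist Sab Sx Sy.
rewrite (ldistC x u) (ldistC x v) in h1 h2 h3.
by do 6 (case => -[? ?]); olra.
Qed.

(** The tails of [S] and [T] beyond [w] meet only in [w], so by axiom (i) their union is a segment
    and one of [y], [w], [z] lies between the other two. If it is [y] or [z], that point lies on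
    both tails and so equals [w]. *)
Lemma meet_btw x y z S T w : segment_between x y S -> segment_between x z T ->
  S w -> T w -> (forall u, S u -> T u -> ldist x u <= ldist x w) ->
  ldist y w + ldist w z = ldist y z.
Proof.
move=> Sxy Txz Sw Tw hw.
have S'wy := segment_tail Sxy Sw; have T'wz := segment_tail Txz Tw.
set S' := [set u | _] in S'wy; set T' := [set u | _] in T'wz.
have ST : S' `&` T' = [set w].
  apply/seteqP; split => u /= => [[[Su ?] [Tu ?]]|->]; last by split; split.
  by apply: (segment_inj Sxy Su Sw); have := hw u Su Tu => ?; olra.
have K : segment (S' `|` T').
  by have [_ hU _] := X_tree; apply: (hU S' T' w _ _ ST); [exists y; left|exists z; left].
have Kw : (S' `|` T') w by left; split.
have S'y := segment_mem_l (segment_betweenC S'wy).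
have T'z := segment_mem_l (segment_betweenC T'wz).
case: (segment_three K (or_introl S'y) (or_intror T'z) Kw) => // h.
- have [|v T'v wv] := @segment_point _ _ _ (ldist w y) T'wz (ldist_ge0 _ _).
    by have := ldist_ge0 y z => ?; olra.
  have yv : y = v.
    by apply: (segment_btw_inj K Kw (or_intror T'z) (or_introl S'y) (or_intror T'v)) => //;
      exact: segment_btw T'v.
  have : (S' `&` T') y by split => //; rewrite yv.
  by rewrite ST => ->; rewrite ldistxx add0r.
- have [|v S'v wv] := @segment_point _ _ _ (ldist w z) S'wy (ldist_ge0 _ _).
    by have := ldist_ge0 z y => ?; olra.
  have zv : z = v.
    by apply: (segment_btw_inj K Kw (or_introl S'y) (or_intror T'z) (or_introl S'v)) => //;
      exact: segment_btw S'v.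
  have : (S' `&` T') z by split => //; rewrite zv.
  by rewrite ST => ->; rewrite ldistxx addr0.
Qed.

Lemma tree_median x y z : exists w,
  [/\ ldist x w + ldist w y = ldist x y, ldist x w + ldist w z = ldist x z
    & ldist y w + ldist w z = ldist y z].
Proof.
have [geo _ _] := X_tree; have [S Sxy] := geo x y; have [T Txz] := geo x z.
have [w [Sw Tw _ hw]] := segment_meet Sxy Txz; exists w; split.
- exact: segment_btw Sw.
- exact: segment_btw Tw.
- exact: meet_btw hw.
Qed.

(** Of the two points where $[x,z]$ and $[x,t]$ leave $[x,y]$, the one nearer to [x] lies on all
    three segments; the bound follows from the path from [z] to [t] through it. *)
Lemma tree_four_point x y z t :
  ldist x y + ldist z t <= ldist x z + ldist y t \/
  ldist x y + ldist z t <= ldist x t + ldist y z.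
Proof.
have [geo _ _] := X_tree; have [S Sxy] := geo x y.
have [T Txz] := geo x z; have [U Uxt] := geo x t.
have [w1 [Sw1 Tw1 h1 m1]] := segment_meet Sxy Txz.
have [w2 [Sw2 Uw2 h2 m2]] := segment_meet Sxy Uxt.
have b1 := meet_btw Sxy Txz Sw1 Tw1 m1; have b2 := meet_btw Sxy Uxt Sw2 Uw2 m2.
have e1 := segment_btw Sxy Sw1; have e2 := segment_btw Sxy Sw2.
have e3 := segment_btw Txz Tw1; have e4 := segment_btw Uxt Uw2.
case: (oleVlt (ldist x w1) (ldist x w2)) => ?; [right|left].
- have Uw1 : U w1 by exact: h2.
  have e5 := segment_btw Uxt Uw1; have := ldist_triangle z w1 t.
  by rewrite (ldistC z w1) (ldistC y w1) in b1 * => ?; olra.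
- have Tw2 : T w2 by apply: h1 => //; olra.
  have e5 := segment_btw Txz Tw2; have := ldist_triangle z w2 t.
  by rewrite (ldistC z w2) (ldistC y w2) in b2 * => ?; olra.
Qed.

End Segments.

(** * Axes of hyperbolic isometries *)

Section Action.
Variables (L : orderedZmodType) (X : lambdaMetricType L).
Hypothesis X_tree : lambda_tree X.
Variables (G : groupType) (act : G -> X -> X).
Hypothesis act_isom : isometric_action act.
Implicit Types (g h k : G) (x y z p q m w : X).
Local Notation d := (@ldist L X).

Lemma act1 x : act 1%g x = x. Proof. by case: act_isom. Qed.
Lemma actM g h x : act (g * h)%g x = act g (act h x). Proof. by case: act_isom. Qed.
Lemma ldist_act g x y : d (act g x) (act g y) = d x y.
Proof. by case: act_isom => _ _ /(_ g)[]. Qed.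
Lemma actK g x : act g^-1%g (act g x) = x. Proof. by rewrite -actM mulVg act1. Qed.
Lemma actVK g x : act g (act g^-1%g x) = x. Proof. by rewrite -actM mulgV act1. Qed.
Lemma ldist_actl g x y : d (act g x) y = d x (act g^-1%g y).
Proof. by rewrite -(ldist_act g^-1%g) actK. Qed.

(** Four-point inequality for $p, g^2p, gp, gx$; both $d(gp,x)$ and $d(p,gx)$ are at most $d(p,x) +
    d(x,gx)$. *)
Lemma displacement_sq_le g p x :
  d p (act g (act g p)) <= d p (act g p) + d x (act g x).
Proof.
have := tree_four_point X_tree p (act g (act g p)) (act g p) (act g x).
have := ldist_triangle (act g p) (act g x) x; have := ldist_triangle p x (act g x).
have := ldistC (act g (act g p)) (act g p); have := ldistC (act g x) x.
have := ldistC (act g p) x; have := ldistC p x.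
by rewrite !ldist_act => ? ? ? ? ? ? [?|?]; olra.
Qed.

(** The last clause excludes inversions, which can also attain a positive minimal displacement, as
    the flip of an edge of a $\mathbb{Z}$-tree does. *)
Definition hyperbolic_of_length g (l : L) : Prop :=
  [/\ 0 < l, exists x, d x (act g x) = l, forall x, l <= d x (act g x)
    & forall x, act g (act g x) <> x].

(** A positive value is neither the 0 assigned to inversions nor the default 0 of [xget], so it is a
    genuine minimum. *)
Lemma translation_length_le g x : 0 < translation_length (act g) ->
  translation_length (act g) <= d x (act g x).
Proof.
rewrite /translation_length; case: asboolP => _; first by rewrite ltxx.
case: xgetP => [l _ [_ lb] _|_]; last by rewrite ltxx.
by apply: lb; exists x.
Qed.

Lemma hyperbolic_translation_length g : 0 < translation_length (act g) ->
  hyperbolic_of_length g (translation_length (act g)).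
Proof.
move=> l0; have lx x := translation_length_le x l0.
have nofix x : act g x <> x.
  by move=> gx; have := lx x; rewrite gx ldistxx => ?; olra.
split => //; last first.
- move=> x ggx; move: l0; rewrite /translation_length asboolT ?ltxx //.
  by split=> //; exists x.
- move: l0; rewrite /translation_length; case: asboolP => _; first by rewrite ltxx.
  by case: xgetP => [_ _ [[x _ <-]] _ _|_]; [exists x|rewrite ltxx].
Qed.

(* The median of [g^-1 y], [y] and [g y] is the projection of [y] on the axis
   of [g]. *)
Lemma axis_projection g l y : hyperbolic_of_length g l -> exists m,
  [/\ d m (act g m) = l, d y (act g y) = d y m + d y m + l,
      d y (act g m) = d y m + l, d y (act g^-1%g m) = d y m + l
    & d y (act g (act g y)) = d y m + d y m + l + l].
Proof.
move=> [l0 [x xl] lmin nofix2].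
have [m [h1 h2 h3]] := tree_median X_tree (act g^-1%g y) y (act g y).
have d1 : d (act g^-1%g y) m = d y (act g m) by rewrite ldist_actl invgK.
have d2 : d (act g^-1%g y) y = d y (act g y) by rewrite ldist_actl invgK.
have d3 : d (act g^-1%g y) (act g y) = d y (act g (act g y)) by rewrite ldist_actl invgK.
have d4 : d m (act g y) = d y (act g^-1%g m) by rewrite ldistC ldist_actl.
have d5 := ldistC m y; rewrite {}d1 {}d2 {}d3 {}d4 {}d5 in h1 h2 h3.
have fp := tree_four_point X_tree.
have e1 := ldistC m (act g m); have e2 : d (act g y) (act g m) = d y m by rewrite ldist_act.
have e3 : d (act g y) m = d y (act g^-1%g m) by rewrite ldist_actl.
case: (oleVlt (d y m + d y m) (d y (act g y))) => [le|lt].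
  (* The four-point inequality gives $d(m,gm) \le d(y,gy) - 2d(y,m)$, and [displacement_sq_le] at a
     point [x] of minimal displacement bounds the right side by [l]. *)
  exists m; have lm := lmin m; have lb := displacement_sq_le g y x.
  have lm' : d m (act g m) <= d y (act g y) - (d y m + d y m).
    by case: (fp y (act g y) m (act g m)) => ?; olra.
  by split; olra.
(* Otherwise [g m] and [g^-1 m] are the same point of the segment from [y] to
   [g^-1 y]. *)
exfalso; apply: (nofix2 m).
suff : act g m = act g^-1%g m by move=> {1}->; rewrite actVK.
apply/(@ldist_eq0 _ _ (act g m) (act g^-1%g m)).
have n0 := ldist_ge0 (act g m) (act g^-1%g m).
have lm' : d m (act g m) <= (d y m + d y m) - d y (act g y).
  by case: (fp y (act g y) m (act g m)) => ?; olra.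
have t1 := ldist_triangle (act g m) m (act g^-1%g y).
have d1 : d (act g^-1%g y) m = d y (act g m) by rewrite ldist_actl invgK.
have d2 : d (act g^-1%g y) y = d y (act g y) by rewrite ldist_actl invgK.
have d3 : d (act g^-1%g y) (act g^-1%g m) = d y m by rewrite ldist_act.
have c1 := ldistC (act g^-1%g y) m; have c2 := ldistC (act g^-1%g y) y.
have c3 := ldistC (act g^-1%g y) (act g m).
by case: (fp y (act g^-1%g y) (act g m) (act g^-1%g m)) => ?; olra.
Qed.

(** Here [q] is the projection of [p] on the axis of [g], and [y] is on that axis. If [q] were not
    between [p] and [y], both $gq$ and $g^{-1}q$ would be at distance at least $d(q,y) + l$ from
    [y], against the four-point inequality for $y, gq, q, gy$. *)
Lemma axis_projection_btw g (l : L) p q y : 0 < l -> d y (act g y) = l ->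
  d q (act g q) = l -> d p (act g q) = d p q + l ->
  d p (act g^-1%g q) = d p q + l -> d p q + d q y <= d p y.
Proof.
move=> l0 yl ql pq1 pq2; apply: ole_by_contra => lt.
have fp := tree_four_point X_tree.
have c1 := ldistC q p; have c2 := ldistC q y; have t := ldist_triangle p y q.
have hy : forall h, d q (act h q) = l -> d p (act h q) = d p q + l ->
    d q y + l <= d y (act h q).
  by move=> h e1 e2; case: (fp p (act h q) q y) => ?;
    have := ldistC (act h q) y => ?; have := ldistC (act h q) q => ?; olra.
have h1 := hy g ql pq1.
have qVl : d q (act g^-1%g q) = l by rewrite ldistC ldist_actl invgK.
have h2 := hy g^-1%g qVl pq2.
have e1 : d q (act g y) = d y (act g^-1%g q) by rewrite ldistC ldist_actl.
have e2 : d (act g q) (act g y) = d q y by rewrite ldist_act.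
by case: (fp y (act g q) q (act g y)) => ?;
  have := ldist_ge0 q y; have := ldistC (act g q) q => ? ?; olra.
Qed.

(** In Gromov products at [p], the conclusion reads $(gp|hp) + (g^{-1}p|h^{-1}p) < l_g$: the overlap
    is shorter than the smaller length. Otherwise the point [w] where $[p,g^{-1}p]$ and
    $[p,h^{-1}p]$ separate satisfies $d(gw,hw) \le l_h - l_g$. *)
Lemma axes_overlap_lt g h (lg lh : L) p : lg <= lh ->
  d p (act g p) = lg -> d p (act h p) = lh ->
  (forall z, lh - lg < d (act g z) (act h z)) ->
  lh + lh < d (act g p) (act h p) + d (act g^-1%g p) (act h^-1%g p).
Proof.
move=> gh eg eh hz; apply: olt_by_contra => le.
have [w [w1 w2 w3]] := tree_median X_tree p (act g^-1%g p) (act h^-1%g p).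
have fp := tree_four_point X_tree.
have e1 : d p (act g^-1%g p) = lg by rewrite ldistC ldist_actl invgK.
have e2 : d p (act h^-1%g p) = lh by rewrite ldistC ldist_actl invgK.
have e3 : d (act g w) (act g p) = d p w by rewrite ldist_act ldistC.
have e4 : d (act h w) (act h p) = d p w by rewrite ldist_act ldistC.
have e5 : d p (act g w) = d w (act g^-1%g p) by rewrite ldistC ldist_actl.
have e6 : d p (act h w) = d w (act h^-1%g p) by rewrite ldistC ldist_actl.
have e7 := ldistC (act g^-1%g p) w.
have wz := hz w.
have gwhp : d (act g w) (act h p) <= lh - lg + d p w.
  case: (fp p (act g p) (act g w) (act h p)) => ?;
  have := ldistC (act g p) (act g w); have := ldistC (act g p) (act h p) => ? ?; olra.
case: (fp p (act h p) (act g w) (act h w)) => ?;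
have := ldistC (act h p) (act h w); have := ldistC (act h p) (act g w) => ? ?; olra.
Qed.

End Action.

(** * Words and free bases *)

Section Words.
Variable n : nat.
Local Open Scope group_scope.

(* [(i, false)] stands for the [i]-th generator, [(i, true)] for its inverse. *)
Local Notation letter := ('I_n * bool)%type.

Definition linv (s : letter) : letter := (s.1, ~~ s.2).

Definition follows : rel letter := fun s t => t != linv s.

Definition reduced : pred (seq letter) := sorted follows.

Lemma linvK : involutive linv.
Proof. by move=> [i b]; rewrite /linv /= negbK. Qed.

Definition lpush (s : letter) (w : seq letter) : seq letter :=
  if w is t :: w' then if follows s t then s :: w else w' else [:: s].

Lemma reduced_lpush s w : reduced w -> reduced (lpush s w).
Proof.
by rewrite /reduced; case: w => [|t w] //=; case: ifP => /= [-> ->|_ /path_sorted].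
Qed.

Definition reduce : seq letter -> seq letter := foldr lpush [::].

Lemma reduced_reduce w : reduced (reduce w).
Proof. by elim: w => //= s w; apply: reduced_lpush. Qed.

Section Values.
Variables (F : groupType) (e : 'I_n -> F).

Definition lval (s : letter) : F := if s.2 then (e s.1)^-1 else e s.1.

Fixpoint wval (w : seq letter) : F :=
  if w is s :: w' then lval s * wval w' else 1.

Lemma lval_inv s : lval (linv s) = (lval s)^-1.
Proof. by rewrite /lval; case: s => i [] //=; rewrite invgK. Qed.

Lemma wval_cat w1 w2 : wval (w1 ++ w2) = wval w1 * wval w2.
Proof. by elim: w1 => [|s w IH] /=; rewrite ?mul1g // IH mulgA. Qed.

Lemma wval_rcons w s : wval (rcons w s) = wval w * lval s.
Proof. by rewrite -cats1 wval_cat /= mulg1. Qed.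

Lemma wval_rev_inv w : wval (rev (map linv w)) = (wval w)^-1.
Proof.
elim: w => [|s w IH] /=; first by rewrite invg1.
by rewrite rev_cons wval_rcons IH lval_inv invgM.
Qed.

Lemma wval_lpush s w : wval (lpush s w) = lval s * wval w.
Proof.
case: w => //= t w; case: ifP => //= /negbFE/eqP ->.
by rewrite lval_inv mulgA mulgV mul1g.
Qed.

Lemma wval_reduce w : wval (reduce w) = wval w.
Proof. by elim: w => //= s w IH; rewrite wval_lpush IH. Qed.

End Values.

Lemma wval_morph (F K : groupType) (phi : {multiplicative F -> K}) (e : 'I_n -> F) w :
  phi (wval e w) = wval (phi \o e) w.
Proof.
have phi1 : phi 1 = 1 by apply: (mulgI (phi 1)); rewrite -gmulfM !mulg1.
have phiV x : phi x^-1 = (phi x)^-1.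
  by apply: (mulgI (phi x)); rewrite -gmulfM !mulgV.
by elim: w => [//|[i []] w IH] /=; rewrite gmulfM IH /lval /= ?phiV.
Qed.

(** If two words have the same value under [e], the first times the inverse of the second reduces to
    the empty word, so their values under [f] agree too. The morphism can thus be read off any
    chosen word for each element. *)
Lemma free_basis_reduced (F : groupType) (e : 'I_n -> F) :
  (forall g, exists w, wval e w = g) ->
  (forall w, reduced w -> w != [::] -> wval e w <> 1) ->
  free_basis e.
Proof.
move=> gen red K f.
have ker w : wval e w = 1 -> wval f w = 1.
  rewrite -wval_reduce -[wval f w]wval_reduce => w1.
  case: (eqVneq (reduce w) [::]) => [-> //|w0].
  by case: (red _ (reduced_reduce w) w0).
have compat w1 w2 : wval e w1 = wval e w2 -> wval f w1 = wval f w2.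
  move=> w12; have := ker (w1 ++ rev (map linv w2)).
  rewrite !wval_cat !wval_rev_inv w12 mulgV => /(_ erefl) h.
  by rewrite -[RHS]mul1g -h mulgVK.
pose w_ g := sval (cid (gen g)).
have w_E g : wval e (w_ g) = g by rewrite /w_; case: cid.
pose phi g := wval f (w_ g).
have phiM : {morph phi : x y / x * y}.
  by move=> x y; rewrite /phi -wval_cat; apply: compat; rewrite wval_cat !w_E.
have phi1 : phi 1 = 1 by apply: (@ker (w_ 1)); rewrite w_E.
pose phiH := isMultiplicative.Build F K phi phiM.
pose phiT : {multiplicative F -> K} := HB.pack phi phiH.
exists phiT => [i|psi psif g].
  rewrite /= /phi (compat _ [:: (i, false)]) ?w_E /= /lval /= ?mulg1 //.
rewrite -[in LHS](w_E g) wval_morph /= /phi; congr wval.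
by apply/funext => i; rewrite /= psif.
Qed.

End Words.

Arguments follows {n}.
Arguments reduced {n}.
Arguments linv {n}.

(** * Displacement of reduced words *)

Section LocalToGlobal.
Variables (L : orderedZmodType) (X : lambdaMetricType L).
Hypothesis X_tree : lambda_tree X.
Variables (G : groupType) (act : G -> X -> X).
Hypothesis act_isom : isometric_action act.
Variables (n : nat) (e : 'I_n -> G) (p : X).

Local Notation letter := ('I_n * bool)%type.
Local Notation val := (lval e).
Implicit Types (s t u : letter) (w : seq letter).

Definition olen (g : G) : L := ldist p (act g p).

(** Twice the length of what remains of $[p,tp]$ outside its overlaps with $[p,s^{-1}p]$ and
    $[tp,tup]$; negative if these overlap each other. *)
Definition triple_gap s t u : L :=
  olen (val s * val t)%g + olen (val t * val u)%g - (olen (val s) + olen (val u)).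

Hypothesis gap_gt0 : forall s t u, follows s t -> follows t u -> 0 < triple_gap s t u.

(** Two instances of the four-point inequality for $p, gp, ghp, ghkp$. *)
Lemma olenM_four (g h k : G) :
  (olen (g * (h * k))%g + olen h <= olen (g * h)%g + olen (h * k)%g \/
   olen (g * (h * k))%g + olen h <= olen g + olen k) /\
  (olen (g * h)%g + olen (h * k)%g <= olen (g * (h * k))%g + olen h \/
   olen (g * h)%g + olen (h * k)%g <= olen g + olen k).
Proof.
have dM (f f' : G) : ldist (act f p) (act (f * f')%g p) = olen f'.
  by rewrite (actM act_isom) (ldist_act act_isom).
have e1 := dM g h.
have e2 : ldist (act g p) (act (g * (h * k))%g p) = olen (h * k)%g by [].
have e3 : ldist (act (g * h)%g p) (act (g * (h * k))%g p) = olen k.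
  by rewrite mulgA dM.
have := ldistC (act (g * h)%g p) (act g p).
have := ldistC (act (g * h)%g p) (act (g * (h * k))%g p).
have := ldistC (act g p) (act (g * (h * k))%g p).
move=> ? ? ?; split.
  case: (tree_four_point X_tree p (act (g * (h * k))%g p) (act g p) (act (g * h)%g p)).
    rewrite -!/(olen _) => ?.
    by right; olra.
  by rewrite -!/(olen _) => ?; left; olra.
case: (tree_four_point X_tree p (act (g * h)%g p) (act g p) (act (g * (h * k))%g p)).
  by rewrite -!/(olen _) => ?; right; olra.
by rewrite -!/(olen _) => ?; left; olra.
Qed.

(** In the four-point inequality for [s], [t] and the rest of the word, the induction hypothesis and
    the positive gap make one of the three sums strictly smaller than another; the two largest are
    then equal. *)
Lemma olen_cons s t w : path follows s (t :: w) ->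
  olen (wval e [:: s, t & w]) + olen (val t) =
  olen (val s * val t)%g + olen (wval e (t :: w)).
Proof.
elim: w s t => [|u w IH] s t /=; first by rewrite !mulg1.
move=> /and3P[st tu uw].
have := IH t u; rewrite /= tu uw => /(_ isT) IHw.
have := gap_gt0 st tu; rewrite /triple_gap.
have [] := olenM_four (val s) (val t) (val u * wval e w)%g.
by move=> -[?|?] [?|?] ?; olra.
Qed.

(* A letter [z] followed by [t] contributes its length minus twice the Gromov
   product of [z^-1 p] and [t p] at [p]. *)
Fixpoint gain (z : letter) w : L :=
  if w is t :: w' then olen (val z * val t)%g - olen (val t) + gain t w' else 0.

Lemma gain_cat z w1 w2 : gain z (w1 ++ w2) = gain z w1 + gain (last z w1) w2.
Proof. by elim: w1 z => [|t w IH] z /=; rewrite ?add0r // IH addrA. Qed.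

Lemma olen_path z w : path follows z w ->
  olen (wval e (z :: w)) = gain z w + olen (val (last z w)).
Proof.
elim: w z => [|t w IH] z; first by rewrite /= mulg1 add0r.
move=> ztw; have := olen_cons ztw; have /= /andP[_ tw] := ztw.
by have := IH t tw; rewrite /= => ? ?; olra.
Qed.

(** Twice the gain is the sum of the gaps of all consecutive triples plus the boundary terms on the
    left; the gaps are dropped. [y] is the last letter but one. *)
Lemma gain_ge z t w : path follows z (t :: w) -> exists2 y, follows y (last t w) &
  olen (val z * val t)%g + olen (val z) - olen (val t) +
  (olen (val y * val (last t w))%g - olen (val y) - olen (val (last t w)))
  <= gain z (t :: w) *+ 2.
Proof.
elim: w z t => [|u w IH] z t /= /andP[zt tw]; first by exists z => //; olra.
have [y yl le] := IH t u tw; exists y => //.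
have /andP[tu _] := tw; have := gap_gt0 zt tu; rewrite /triple_gap.
by rewrite /= in le * => ?; olra.
Qed.

(** For a cyclically reduced word $g$, $l(g^2) - l(g)$ is the gain once around the cycle. The
    boundary terms of [gain_ge] then add up to the gap of the triple [y], [z], [s]. *)
Lemma displacement_cyclic (eps : L) s w :
  (forall s t u, follows s t -> follows t u -> eps <= triple_gap s t u) ->
  path follows s w -> follows (last s w) s ->
  forall x, eps <= ldist x (act (wval e (s :: w)) x) *+ 2.
Proof.
move=> heps sw ls x; set z := last s w in ls *.
have zsw : path follows z (s :: w) by rewrite /= ls.
have ssw : path follows s (w ++ s :: w) by rewrite cat_path sw.
have := displacement_sq_le X_tree act_isom (wval e (s :: w)) p x.
rewrite -(actM act_isom) -wval_cat cat_cons -!/(olen _) !olen_path //.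
rewrite gain_cat last_cat /= -/z.
have [y yz] := gain_ge zsw; rewrite /= -/z in yz *.
by have := heps _ _ _ yz ls; rewrite /triple_gap => ? ? ?; olra.
Qed.

(** While the last letter is the inverse of the first, conjugation shortens the word; it only moves
    the point, and the bound is uniform in [x]. *)
Lemma displacement_reduced (eps : L) w :
  (forall s t u, follows s t -> follows t u -> eps <= triple_gap s t u) ->
  reduced w -> w != [::] -> forall x, eps <= ldist x (act (wval e w) x) *+ 2.
Proof.
move=> heps; have [m] := ubnP (size w); elim: m w => // m IH [//|s w] sz rw _ x.
case: (boolP (follows (last s w) s)) => [ls|/negbNE/eqP sl].
  exact: displacement_cyclic ls x.
case: (lastP w) sz rw sl => [|w' l] sz rw; rewrite ?last_rcons /= => sl.
  by case: s sl {sz rw} => i []; case.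
have w'0 : w' != [::].
  apply/eqP => w'0; move: rw; rewrite w'0 /reduced /= andbT sl.
  by rewrite /follows linvK eqxx.
rewrite wval_rcons (actM act_isom) -(ldist_act act_isom (val s)^-1%g).
rewrite (actK act_isom) (actM act_isom).
have -> : val l = (val s)^-1%g by rewrite sl lval_inv invgK.
apply: IH => //.
  by rewrite /= size_rcons in sz; exact: ltnW.
by move: rw; rewrite /reduced /= rcons_path => /andP[/path_sorted].
Qed.
End LocalToGlobal.

(** [L] need not be divisible. If no positive element has its double below [eps], then [eps] itself
    works: $x < eps \le 2x$ would make [x] or [eps - x] such an element. *)
Lemma exists_half (L : orderedZmodType) (eps : L) : 0 < eps ->
  exists2 del, 0 < del & forall x, eps <= x *+ 2 -> del <= x.
Proof.
move=> eps0; case: (pselect (exists2 x : L, 0 < x & x *+ 2 <= eps)) => [[x x0 xe]|no].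
  by exists x => // y ye; olra.
exists eps => // x xe; apply: ole_by_contra => lt; apply: no.
by case: (oleVlt (x *+ 2) eps) => ?; [exists x => //|exists (eps - x)]; olra.
Qed.

Lemma exists_positive_lower_bound (L : orderedZmodType) (T : finType) (P : pred T)
    (f : T -> L) : (exists l : L, 0 < l) -> (forall x, P x -> 0 < f x) ->
  exists2 eps, 0 < eps & forall x, P x -> eps <= f x.
Proof.
move=> [l l0] f0.
suff [eps eps0 epsP] : exists2 eps : L, 0 < eps &
    forall x, x \in enum T -> P x -> eps <= f x.
  by exists eps => // x; apply: epsP; rewrite mem_enum.
elim: (enum T) => [|y r [eps eps0 IH]]; first by exists l.
case: (boolP (P y)) => [/f0 y0|/negPf nPy]; last first.
  by exists eps => // x; rewrite inE => /predU1P[->|/IH//]; rewrite nPy.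
case: (oleVlt eps (f y)) => le; [exists eps|exists (f y)] => // x;
  by rewrite inE => /predU1P[->|/IH h] // /h ?; olra.
Qed.

(** * The base point of a ping-pong pair *)

Definition pair_of (T : Type) (a b : T) (i : 'I_2) : T := if val i == 0%N then a else b.

Section BasePoint.
Variables (L : orderedZmodType) (X : lambdaMetricType L).
Hypothesis X_tree : lambda_tree X.
Variables (G : groupType) (act : G -> X -> X).
Hypothesis act_isom : isometric_action act.
Implicit Types (g h a b : G) (p x y z : X).

Local Notation len p := (olen act p).

Lemma ldist_olen p g h : ldist (act g p) (act h p) = len p (g^-1 * h)%g.
Proof. by rewrite (ldist_actl act_isom) -(actM act_isom). Qed.

Lemma olenV p g : len p g^-1%g = len p g.
Proof. by rewrite /olen ldistC (ldist_actl act_isom) invgK. Qed.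

Lemma olenM_le p g h : len p (g * h)%g <= len p g + len p h.
Proof.
rewrite -[len p h](ldist_act act_isom g) /olen (actM act_isom).
exact: ldist_triangle.
Qed.

(* The three cases are disjoint axes, and overlapping axes with the same and with
   opposite orientations. *)
Lemma triple_gap_pair_gt0 p a b :
  [\/ [/\ 0 < len p a, 0 < len p b, len p a *+ 2 <= len p (a * a)%g
        & len p b < len p (b * b)%g] /\
      [/\ len p a + len p b <= len p (a * b)%g,
          len p a + len p b <= len p (b * a)%g,
          len p a + len p b <= len p (a * b^-1)%g
        & len p a + len p b <= len p (a^-1 * b)%g],
      [/\ 0 < len p a, 0 < len p b, len p a *+ 2 <= len p (a * a)%g
        & len p b *+ 2 <= len p (b * b)%g] /\
      [/\ len p a + len p b <= len p (a * b)%g,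
          len p a + len p b <= len p (b * a)%g,
          len p a *+ 2 < len p (a^-1 * b)%g + len p (a * b^-1)%g
        & len p b *+ 2 < len p (a^-1 * b)%g + len p (a * b^-1)%g]
    | [/\ 0 < len p a, 0 < len p b, len p a *+ 2 <= len p (a * a)%g
        & len p b *+ 2 <= len p (b * b)%g] /\
      [/\ len p a + len p b <= len p (a * b^-1)%g,
          len p a + len p b <= len p (a^-1 * b)%g,
          len p a *+ 2 < len p (a * b)%g + len p (b * a)%g
        & len p b *+ 2 < len p (a * b)%g + len p (b * a)%g]] ->
  forall s t u, follows s t -> follows t u -> 0 < triple_gap act (pair_of a b) p s t u.
Proof.
(* Invariance of length under inversion leaves eight unknown lengths. *)
have c1 := olenV p a; have c2 := olenV p b.
have c3 : len p (a^-1 * a^-1)%g = len p (a * a)%g by rewrite -invgM olenV.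
have c4 : len p (b^-1 * b^-1)%g = len p (b * b)%g by rewrite -invgM olenV.
have c5 : len p (b^-1 * a^-1)%g = len p (a * b)%g by rewrite -invgM olenV.
have c6 : len p (a^-1 * b^-1)%g = len p (b * a)%g by rewrite -invgM olenV.
have c7 : len p (b * a^-1)%g = len p (a * b^-1)%g by rewrite -olenV invgM invgK.
have c8 : len p (b^-1 * a)%g = len p (a^-1 * b)%g by rewrite -olenV invgM invgK.
have t1 := olenM_le p a b; have t2 := olenM_le p b a.
have t3 := olenM_le p a b^-1%g; have t4 := olenM_le p a^-1%g b.
move=> hyp [[[|[|//]] i1] []] [[[|[|//]] i2] []] [[[|[|//]] i3] []];
rewrite /follows /linv !xpair_eqE -!val_eqE //= => _ _;
rewrite /triple_gap /lval /pair_of /=; case: hyp => -[[? ? ? ?] [? ? ? ?]]; olra.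
Qed.

Lemma exists_base_point a b (la lb : L) :
  hyperbolic_of_length act a la -> hyperbolic_of_length act b lb ->
  (forall z, oabs (la - lb) < ldist (act a z) (act b z)) ->
  (forall z, oabs (la - lb) < ldist (act a z) (act b^-1%g z)) ->
  exists p, forall s t u, follows s t -> follows t u ->
    0 < triple_gap act (pair_of a b) p s t u.
Proof.
move=> ha hb hab habV.
(* [y] lies on the axis of [b], [p] is its projection on the axis of [a], and [q] is the projection
   of [p] on the axis of [b]. *)
have [la0 _ _ _] := ha; have [lb0 [y yb] _ _] := hb.
have [p [pa ya yap yaVp _]] := axis_projection X_tree act_isom y ha.
have [q [qb pb pbq pbVq pbb]] := axis_projection X_tree act_isom p hb.
have paa : len p (a * a)%g = la *+ 2.
  have [m [_ e1 _ _ e2]] := axis_projection X_tree act_isom p ha.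
  by rewrite /olen (actM act_isom); have := ldist_ge0 p m => ?; olra.
have {}pbb : len p (b * b)%g = ldist p q *+ 2 + lb *+ 2.
  by rewrite /olen (actM act_isom) pbb; olra.
have fp := tree_four_point X_tree.
exists p; apply: triple_gap_pair_gt0.
have dM g h : ldist (act g p) (act h p) = len p (g^-1 * h)%g := ldist_olen p g h.
have e1 := dM a b; have e2 := dM a^-1%g b; have e3 := dM a b^-1%g.
have e4 := dM a^-1%g b^-1%g; have e5 := dM a^-1%g a; have e6 := dM b^-1%g b.
have e7 : len p (a^-1 * b^-1)%g = len p (b * a)%g by rewrite -invgM olenV.
rewrite !invgK {}e7 in e1 e2 e3 e4 e5 e6.
have laE : len p a = la by [].
have lbE : len p b = ldist p q *+ 2 + lb by rewrite /olen pb; olra.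
have laV := olenV p a; have lbV := olenV p b.
have [pq0|pq0] : ldist p q = 0 \/ 0 < ldist p q.
  by have := ldist_ge0 p q; case: (oleVlt (ldist p q) 0) => ? ?; [left; olra|right].
  have abs_ge : la - lb <= oabs (la - lb) /\ lb - la <= oabs (la - lb).
    by case: (oabsP (la - lb)) => -[? ->]; split; olra.
  case: abs_ge => abs1 abs2.
  have overlap g h : len p g = la -> len p h = lb ->
      (forall z, oabs (la - lb) < ldist (act g z) (act h z)) ->
      la *+ 2 < ldist (act g p) (act h p) + ldist (act g^-1%g p) (act h^-1%g p) /\
      lb *+ 2 < ldist (act g p) (act h p) + ldist (act g^-1%g p) (act h^-1%g p).
    move=> eg eh hz; case: (oleVlt la lb) => le.
      have hz' z : lb - la < ldist (act g z) (act h z) by have := hz z => ?; olra.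
      by have := axes_overlap_lt X_tree act_isom le eg eh hz' => ?; split; olra.
    have hz' z : la - lb < ldist (act h z) (act g z).
      by have := hz z; rewrite ldistC => ?; olra.
    have := axes_overlap_lt X_tree act_isom (ltW le) eh eg hz'.
    by rewrite ldistC (ldistC (act h^-1%g p)) => ?; split; olra.
  have lbE' : len p b = lb by olra.
  have lbbE : len p (b * b)%g = lb *+ 2 by olra.
  (* [p] is between $gp$ and $g^{-1}p$, so $[p,hp]$ can start along at most one of these two
     directions. *)
  have split_ends g h l : len p g = l -> len p (g * g)%g = l *+ 2 ->
      len p g + len p h <= ldist (act g p) (act h p) \/
      len p g + len p h <= ldist (act g^-1%g p) (act h p).
    move=> eg egg; have egV := olenV p g.
    have ggV : ldist (act g p) (act g^-1%g p) = l *+ 2.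
      by rewrite ldist_olen // -invgM olenV.
    have := fp p (act h p) (act g p) (act g^-1%g p).
    have := ldistC (act h p) (act g p); have := ldistC (act h p) (act g^-1%g p).
    rewrite -/(len p g) -/(len p h) -/(len p g^-1%g) => ? ? [?|?]; [right|left]; olra.
  have c1 := ldistC (act a p) (act b p); have c2 := ldistC (act a^-1%g p) (act b p).
  have c3 := ldistC (act a p) (act b^-1%g p); have c4 := ldistC (act a^-1%g p) (act b^-1%g p).
  (* The four alternatives are consistent with only two patterns: the axes run in the same or in
     opposite directions. *)
  have [[h3 h4]|[h3 h4]] : (la + lb <= len p (a * b)%g /\ la + lb <= len p (b * a)%g) \/
      (la + lb <= len p (a * b^-1)%g /\ la + lb <= len p (a^-1 * b)%g).
    have := split_ends a b la laE paa; have := split_ends a b^-1%g la laE paa.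
    have := split_ends b a lb lbE' lbbE; have := split_ends b a^-1%g lb lbE' lbbE.
    by move=> [?|?] [?|?] [?|?] [?|?]; solve [left; split; olra|right; split; olra].
  - have [h1 h2] := overlap a b laE lbE' hab.
    by apply: Or32; split; split; olra.
  - have := overlap a b^-1%g laE; rewrite invgK lbV => /(_ lbE' habV)[h1 h2].
    by apply: Or33; split; split; olra.
have Db := axis_projection_btw X_tree act_isom lb0 yb qb pbq pbVq.
(* $[p,q]$ is the bridge: $[p,hp]$ starts along it, whereas $[p,gp]$ leaves it at [p], so nothing
   cancels. *)
have far g h : len p g = la -> ldist y (act g p) = ldist y p + la ->
    len p h = len p b -> ldist p (act h^-1%g q) = ldist p q + lb ->
    len p g + len p h <= ldist (act g p) (act h p).
  move=> eg eyg eh ehq.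
  have t := ldist_triangle y q (act g p).
  have := ldistC q y; have := ldistC p y => ? ?.
  have qh : ldist q (act h p) = ldist p q + lb.
    by rewrite ldistC (ldist_actl act_isom).
  have := fp p (act h p) q (act g p); rewrite -/(len p g) -/(len p h).
  have c := ldistC (act h p) q; have c' := ldistC (act h p) (act g p).
  by move=> -[?|?]; olra.
have f1 := far a^-1%g b; have f2 := far a b^-1%g; have f3 := far a^-1%g b^-1%g.
have {}far := far a b; rewrite !invgK ?laV ?lbV in f1 f2 f3 far.
have {}f1 := f1 laE yaVp erefl pbVq; have {}f2 := f2 laE yap erefl pbq.
have {}f3 := f3 laE yaVp erefl pbq; have {}far := far laE yap erefl pbVq.
by apply: Or31; split; split; olra.
Qed.

End BasePoint.

Lemma nbhs_lball (L : orderedZmodType) (X : lambdaMetricType L) (x : X) (r : L) :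
  0 < r -> nbhs x (lball_of (@ldist L X) x r).
Proof.
move=> r0; apply: open_nbhs_nbhs; split; last by rewrite /lball_of /= ldistxx.
by apply: (@lball_basis L X).1; exists x, r.
Qed.

(** Only the identity moves [x0] by less than [del], so the preimage under the orbit map of the ball
    of radius [del] around $gx_0$ isolates $g$. *)
Lemma free_discrete_displacement (L : orderedZmodType) (X : lambdaMetricType L)
    (G : topologicalGroupType) (act : G -> X -> X) (S : set G) (n : nat)
    (e : 'I_n -> G) (del : L) :
  isometric_action act ->
  (exists x0 : X, continuous (fun g : G => act g x0)) ->
  S = range e -> 0 < del ->
  (forall w, reduced w -> w != [::] -> forall x, del <= ldist x (act (wval e w) x)) ->
  free_of_rank n (generated_group S) /\ discrete_space (generated_group S).
Proof.
move=> act_isom [x0 act_cont] Se del0 disp.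
have Sgen i : e i \in generated S.
  by rewrite inE => H [_ SH]; apply: SH; rewrite Se; exists i.
pose e' i : generated_group S := exist _ (e i) (Sgen i).
have val_wval w : val (wval e' w) = wval e w :> G.
  by elim: w => [//|[i []] w IH] /=; rewrite -IH.
have gen g : exists w, wval e' w = g.
  have gS : generated S (val g) by have := valP g; rewrite inE.
  have [w _ wg] : range (wval e) (val g); last first.
    by exists w; apply: val_inj; rewrite val_wval.
  (* The values of words form a subgroup containing [S], and [generated S] is the smallest such. *)
  apply: gS.
  split; last first.
    by rewrite Se => _ [i _ <-]; exists [:: (i, false)] => //=; rewrite mulg1.
  split; first by rewrite inE; exists [::].
  move=> x y; rewrite !inE => -[w _ <-] [w' _ <-].
  by exists (w ++ rev (map linv w')) => //; rewrite wval_cat wval_rev_inv.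
have red w : reduced w -> w != [::] -> wval e' w <> 1%g.
  move=> rw w0 /(congr1 val); rewrite val_wval => w1.
  have := disp w rw w0 x0; rewrite w1 (act1 act_isom) ldistxx => ?.
  olra.
split; first by exists e'; apply: free_basis_reduced.
have small (g : generated_group S) : ldist x0 (act (val g) x0) < del -> g = 1%g.
  have [w <-] := gen g; rewrite val_wval -wval_reduce -(wval_reduce e').
  case: (eqVneq (reduce w) [::]) => [-> //|w0] lt.
  have := disp _ (reduced_reduce w) w0 x0 => ?; olra.
move=> g; apply/seteqP; split => A.
  by move=> gA _ ->; exact: nbhs_singleton gA.
move=> /(_ g erefl) Ag.
have U_nbhs : nbhs (act (val g) x0) (lball_of (@ldist L X) (act (val g) x0) del).
  exact: nbhs_lball.
have V_nbhs : nbhs g [set h : generated_group S |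
    lball_of (@ldist L X) (act (val g) x0) del (act (val h) x0)].
  exact: (@initial_continuous _ _ (val : generated_group S -> G) g _
    (act_cont (val g) _ U_nbhs)).
apply: filterS V_nbhs => h /= gh.
suff -> : h = g by exact: Ag.
have /small : ldist x0 (act (val (g^-1 * h)%g) x0) < del.
  by rewrite /= (actM act_isom) -(ldist_actl act_isom).
by move=> gh1; rewrite -[h]mul1g -(mulgV g) -mulgA gh1 mulg1.
Qed.

Theorem corollary4p2 (L : orderedZmodType)
    (L_nontrivial : exists l : L, l <> 0%R)
    (G : topologicalGroupType) (X : lambdaMetricType L) (X_tree : lambda_tree X)
    (act : G -> X -> X) (act_isom : isometric_action act)
    (act_cont : exists x0 : X, continuous (fun g : G => act g x0))
    (a b : G)
    (ab_pingpong : ping_pong_pair (fun g : G => translation_length (act g)) a b) :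
  free_of_rank 2 (generated_group [set a; b]) /\
  discrete_space (generated_group [set a; b]).
Proof.
have [la0 lb0] := ab_pingpong.
rewrite minElt => lt_min.
set la := translation_length (act a) in la0 lt_min.
set lb := translation_length (act b) in lb0 lt_min.
have abs0 : 0 <= oabs (la - lb) by case: (oabsP (la - lb)) => -[? ->]; olra.
have [ltab ltabV] : oabs (la - lb) < translation_length (act (a * b)%g) /\
    oabs (la - lb) < translation_length (act (a * b^-1)%g).
  move: lt_min; case: ifP => [|/negbT]; last rewrite oltNge negbK; move=> ? ?; split; olra.
have ltabs c : oabs (la - lb) < translation_length (act c) ->
    forall z, oabs (la - lb) < ldist z (act c z).
  move=> ltc z; apply: (lt_le_trans ltc); apply: translation_length_le.
  exact: le_lt_trans ltc.
have [||p gap0] := exists_base_point X_tree act_isom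
    (hyperbolic_translation_length la0) (hyperbolic_translation_length lb0).
(* $d(az,bz)$ is the displacement of $bz$ under $ab^{-1}$; below, $d(az,b^{-1}z)$ is that of
   $b^{-1}z$ under $ab$. *)
- move=> z; have := ltabs _ ltabV (act b z).
  by rewrite (actM act_isom) (actK act_isom) ldistC.
- move=> z; have := ltabs _ ltab (act b^-1%g z).
  by rewrite (actM act_isom) (actVK act_isom) ldistC.
(* There are finitely many triples of letters, so their gaps have a common positive lower bound. *)
pose letter := ('I_2 * bool)%type.
have [|[[s t] u] /= /andP[]|eps eps0 epsP] := @exists_positive_lower_bound L
    (letter * letter * letter)%type (fun x => follows x.1.1 x.1.2 && follows x.1.2 x.2)
    (fun x => triple_gap act (pair_of a b) p x.1.1 x.1.2 x.2).
- by exists la.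
- exact: gap0.
have [del del0 delP] := exists_half eps0.
apply: (@free_discrete_displacement _ _ _ _ _ _ (pair_of a b) _ act_isom act_cont _ del0)
  => [|w rw w0 x].
  apply/seteqP; split => [_ [->|->]|_ [i _ <-]]; first by exists ord0.
    by exists ord_max.
  by rewrite /pair_of; case: ifP; [left|right].
apply/delP/(displacement_reduced X_tree act_isom gap0) => // s t u st tu.
by apply: (epsP (s, t, u)); rewrite /= st tu.
Qed.
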